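(* Let $\mathcal D\subset\mathbb{R}^d$ be the input-parameter domain and let $\mu^{\mathrm{train}}\in\mathcal D$ be the (single) training input. For $\mu\in\mathcal D$ let $w^0(\mu),\dots,w^{n_t}(\mu)\in\mathbb{R}^N$ be the high-dimensional-model states, which satisfy $R^n(w^{n+1}(\mu);\mu)=0$ for $n=0,\dots,n_t-1$, and let the reduced-order-model states be $$\tilde w^n(\mu)=w^0(\mu)+\Phi_w w_r^n(\mu),\qquad n=0,\dots,n_t .$$ Assume the following. 1. The basis matrix $\Phi_w\in\mathbb{R}^{N\times n_w}$ is computed via POD from the snapshot set $\mathsf W_1$ or from the snapshot set $\mathsf W_2$, where $$\mathsf W_1=\{w^n(\mu^{\mathrm{train}})-w^0(\mu^{\mathrm{train}})\mid n=1,\dots,n_t\},\qquad \mathsf W_2=\{w^n(\mu^{\mathrm{train}})-w^{n-1}(\mu^{\mathrm{train}})\mid n=1,\dots,n_t\}.$$ 2. For $n=0,\dots,n_t-1$ and any $\mu\in\mathcal D$, the Gauss–Newton method, started from an initial guess $w_r^{n+1(0)}$, is employed to compute the solution $w_r^{n+1}(\mu)$ to the nonlinear least-squares problem $$w_r^{n+1}(\mu)=\arg\min_{y\in\mathbb{R}^{n_w}} f^n(y;\mu),\qquad f^n(y;\mu)=\tfrac12\big\|\tilde R^n(w^0(\mu)+\Phi_w y;\mu)\big\|_2^2,$$ where $\tilde R^n(w;\mu)=S^n(w,\tilde w^n(\mu),\dots,\tilde w^1(\mu),w^0(\mu);\mu)$ and $S^n(w,w^n(\mu),\dots,w^1(\mu),w^0(\mu);\mu)=R^n(w;\mu)$.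 3. The reduced-order model employs the same initial condition as the high-dimensional model: $w_r^0(\mu)=0$. 4. The standard assumptions for convergence of the Gauss–Newton iterations to a stationary point contained in the level set hold, so that $w_r^{n+1}(\mu)\in\mathcal M^n(\mu)$ for $n=0,\dots,n_t-1$ and any $\mu\in\mathcal D$, where $$\mathcal L^n(\mu)=\{y\mid f^n(y;\mu)\le f^n(w_r^{n+1(0)};\mu)\},\qquad \mathcal M^n(\mu)=\{y\mid y\in\mathcal L^n(\mu),\ \nabla f^n(y;\mu)=0\}.$$ 5. The level set $\mathcal L^n(\mu)$ contains only one stationary point: $|\mathcal M^n(\mu)|=1$ for $n=0,\dots,n_t-1$ and any $\mu\in\mathcal D$. Then the projection approximation is consistent: the Petrov–Galerkin reduced-order model (i.e. the model defined by the least-squares problems $w_r^{n+1}(\mu)=\arg\min_{y\in\mathbb{R}^{n_w}}\tfrac12\big\|\tilde R^n(w^0(\mu)+\Phi_w y;\mu)\big\|_2^2$, $n=0,\dots,n_t-1$, without hyper-reduction) associated with a POD basis $\Phi_w$ that is not truncated computes the same states as the high-dimensional model for the training input, that is, $$\tilde w^n(\mu^{\mathrm{train}})=w^n(\mu^{\mathrm{train}}),\qquad n=0,\dots,n_t .$$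
   Context: The high-dimensional model is a parameterized sequence of $n_t$ systems of nonlinear equations $R^n(w^{n+1};\mu)=0$, $n=0,\dots,n_t-1$, with $R^n:\mathbb{R}^N\times\mathbb{R}^d\to\mathbb{R}^N$, arising from implicit linear multi-step time discretization of an ODE with initial condition $w^0(\mu)$. The residual $R^n(\cdot\,;\mu)$ also depends on the states at previous time steps; the function $S^n$ makes this dependence explicit: $S^n(w,v^n,\dots,v^1,v^0;\mu)$ is the residual at time step $n$ evaluated at the unknown $w$ when the previous states are $v^n,\dots,v^0$. Thus $R^n$ is the residual with the high-dimensional-model previous states inserted, and $\tilde R^n$ is the residual with the reduced-order-model previous states inserted. The functions $f^n$ are assumed differentiable in $y$, as implied by the Gauss–Newton setting. POD: for a snapshot matrix $W\in\mathbb{R}^{N\times n_W}$ whose columns are the snapshots, with thin singular value decomposition $W=U\Sigma V^T$ (singular values in nonincreasing order), a POD basis consists of the leading left singular vectors (columns of $U$); in particular $\Phi_w^T\Phi_w=I$. The POD basis is ''not truncated'' when the range of $\Phi_w$ equals the span of the snapshot set used ($\mathsf W_1$ or $\mathsf W_2$), i.e. all left singular vectors corresponding to nonzero singular values are retained. *)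

(* Defs.v *)
From HB Require Import structures.
From mathcomp Require Import all_boot all_order all_algebra.
From mathcomp Require Import all_classical all_reals all_analysis.
Set Implicit Arguments.
Unset Strict Implicit.
Unset Printing Implicit Defensive.
Import Order.TTheory GRing.Theory Num.Theory.
Import numFieldNormedType.Exports.
Local Open Scope classical_set_scope.
Local Open Scope ring_scope.

Section POD.
Context {R : realType} {N : nat}.

(* Phi consists of the nw leading left singular vectors of a snapshot matrix
   W, i.e. a matrix whose set of columns is the given finite snapshot set (the
   order and the multiplicity of the columns are irrelevant).  Singular
   vectors are not unique; any choice of thin SVD is allowed. *)
Definition thin_svd m (W : 'M[R]_(N, m)) (U : 'M[R]_(N, minn N m))
    (s : 'rV[R]_(minn N m)) (V : 'M[R]_(m, minn N m)) : Prop :=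
  [/\ U^T *m U = 1%:M, V^T *m V = 1%:M,
      forall i, 0 <= s 0 i,
      forall i j : 'I_(minn N m), (i <= j)%N -> s 0 j <= s 0 i
    & W = U *m diag_mx s *m V^T].

Definition pod_basis nw (snapshots : seq 'cV[R]_N) (Phi : 'M[R]_(N, nw)) :
    Prop :=
  exists m (W : 'M[R]_(N, m)) U s V (le_nw : (nw <= minn N m)%N),
    [/\ [seq col j W | j : 'I_m] =i snapshots,
        thin_svd W U s V
      & Phi = colsub (widen_ord le_nw) U].

Definition not_truncated nw (snapshots : seq 'cV[R]_N) (Phi : 'M[R]_(N, nw)) :
    Prop :=
  limg (linfun (mulmx Phi : 'cV[R]_nw -> 'cV[R]_N)) = <<snapshots>>%VS.

Definition snapshots1 (nt : nat) (w : nat -> 'cV[R]_N) : seq 'cV[R]_N :=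
  [seq w n - w 0%N | n <- iota 1 nt].

Definition snapshots2 (nt : nat) (w : nat -> 'cV[R]_N) : seq 'cV[R]_N :=
  [seq w n - w n.-1 | n <- iota 1 nt].

End POD.

Section LeastSquares.
Context {R : realType}.

(* The library's `|v| on 'cV is the sup norm. *)
Definition norm2 m (v : 'cV[R]_m) : R := Num.sqrt (\sum_i v i 0 ^+ 2).

Definition half_sqnorm m (v : 'cV[R]_m) : R := 2^-1 * norm2 v ^+ 2.

Definition argmin T (f : T -> R) : set T := [set y | forall z, f y <= f z].

Definition gradient n (f : 'cV[R]_n -> R) (y : 'cV[R]_n) : 'cV[R]_n :=
  \col_i 'D_(delta_mx i 0) f y.

Definition level_set n (f : 'cV[R]_n -> R) (y0 : 'cV[R]_n) : set 'cV[R]_n :=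
  [set y | f y <= f y0].

Definition stationary_in_level_set n (f : 'cV[R]_n -> R) (y0 : 'cV[R]_n) :
    set 'cV[R]_n :=
  [set y | level_set f y0 y /\ gradient f y = 0].

(* y is computed by the Gauss-Newton method, started from y0, for the
   minimization of |r|_2^2 / 2: the search direction p k solves the linear
   least-squares problem for the residual linearized at the k-th iterate,
   the step length a k > 0 is arbitrary (it may be identically 1, or come from
   a line search), and the iterates converge to y. *)
Definition gauss_newton n m (r : 'cV[R]_n -> 'cV[R]_m) (y0 y : 'cV[R]_n) :
    Prop :=
  exists (it p : nat -> 'cV[R]_n) (a : nat -> R),
    [/\ it 0%N = y0,
        forall k, differentiable r (it k),
        forall k,
          argmin (fun q => half_sqnorm (r (it k) + 'd r (it k) q)) (p k),
        forall k, 0 < a k /\ it k.+1 = it k + a k *: p k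
      & it @ \oo --> y].

End LeastSquares.

Section ROM.
Context {R : realType} {N d nw : nat}.

(* Sres n v h mu is the residual at time step n at the unknown v, where h k is
   the state at time step k, for k = 0, ..., n. *)
Definition residual_family : Type :=
  forall n : nat, 'cV[R]_N -> {ffun 'I_n.+1 -> 'cV[R]_N} -> 'cV[R]_d -> 'cV[R]_N.

Variables (Sres : residual_family) (w : nat -> 'cV[R]_d -> 'cV[R]_N).
Variables (Phi : 'M[R]_(N, nw)) (wr : nat -> 'cV[R]_d -> 'cV[R]_nw).

Definition rom_state (n : nat) (mu : 'cV[R]_d) : 'cV[R]_N :=
  w 0%N mu + Phi *m wr n mu.

Definition rom_residual (n : nat) (v : 'cV[R]_N) (mu : 'cV[R]_d) : 'cV[R]_N :=
  Sres v [ffun k : 'I_n.+1 =>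
         if (k == 0 :> nat)%N then w 0%N mu else rom_state k mu] mu.

Definition reduced_residual (n : nat) (mu : 'cV[R]_d) (y : 'cV[R]_nw) :
    'cV[R]_N :=
  rom_residual n (w 0%N mu + Phi *m y) mu.

Definition objective (n : nat) (mu : 'cV[R]_d) (y : 'cV[R]_nw) : R :=
  half_sqnorm (reduced_residual n mu y).

End ROM.

(* Main.v *)
Require Import Defs.
From HB Require Import structures.
From mathcomp Require Import all_boot all_order all_algebra.
From mathcomp Require Import all_classical all_reals all_analysis.
Set Implicit Arguments.
Unset Strict Implicit.
Unset Printing Implicit Defensive.
Import Order.TTheory GRing.Theory Num.Theory.
Import numFieldNormedType.Exports.
Local Open Scope classical_set_scope.
Local Open Scope card_scope.
Local Open Scope ring_scope.

(** The high-dimensional state is itself reachable by the reduced-order model,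
so it solves the reduced problem exactly; uniqueness then leaves no other
answer.

By strong induction on the time step, assume that the two models agree at all
previous steps.  The reduced residual is then the high-dimensional residual
restricted to the affine space [w^0 + range Phi].  The displacement
[w^(n+1) - w^0] belongs to the span of either snapshot set
([displacement_snapshots1], and by telescoping [displacement_snapshots2]), hence
to the range of a basis that is not truncated, so
[w^(n+1) = w^0 + Phi y] for some coordinates [y].  The residual vanishes there:
[y] is a global minimizer of the nonnegative objective, with value [0].  It
therefore lies in the level set of every initial guess, and it is stationary
([gradient_at_argmin]).  The computed [w_r^(n+1)] is a stationary point
of the same level set, and that set has only one stationary point, so
[w_r^(n+1) = y]. *)

(** Along the line through [y] directed by [v], [f] is a derivable function of one
real variable with a minimum at [0], where Fermat's rule applies. *)
Lemma derive_at_argmin (R : realType) (V : normedModType R) (f : V -> R)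
    (y v : V) :
  (forall x, derivable f x v) -> argmin f y -> 'D_v f y = 0.
Proof.
move=> fdrv fmin; pose g (t : R) := f (t *: v + y).
have quotient (t : R) :
    (fun h : R => h^-1 *: ((g \o shift t) (h *: 1) - g t)) =
    (fun h : R => h^-1 *: ((f \o shift (t *: v + y)) (h *: v) - f (t *: v + y))).
  apply/funext => h; congr (_ *: (f _ - _)).
  by rewrite /= [h *: 1]mulr1 scalerDl addrA.
have gdrv (t : R) : derivable g t 1 by rewrite /derivable quotient; exact: fdrv.
have [_ g'0] : is_derive (0 : R) 1 g 0.
  apply: (@derive1_at_min R g (-1) 1 0).
  - exact: le_trans (lerN10 _) ler01.
  - by move=> t _; exact: gdrv.
  - by rewrite in_itv /= ltrN10 ltr01.
  - by move=> t _; rewrite /g scale0r add0r; exact: fmin.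
by rewrite -g'0 /derive quotient scale0r add0r.
Qed.

Lemma gradient_at_argmin (R : realType) n (f : 'cV[R]_n -> R) (y : 'cV[R]_n) :
  (forall x, differentiable f x) -> argmin f y -> gradient f y = 0.
Proof.
move=> fdiff fmin; apply/colP => i; rewrite !mxE.
by apply: derive_at_argmin => // x; exact: diff_derivable.
Qed.

Lemma half_sqnorm_ge0 (R : realType) m (v : 'cV[R]_m) : 0 <= half_sqnorm v.
Proof. by rewrite mulr_ge0 ?invr_ge0 ?ler0n ?sqr_ge0. Qed.

Lemma half_sqnorm0 (R : realType) m : half_sqnorm (0 : 'cV[R]_m) = 0.
Proof.
rewrite /half_sqnorm /norm2 big1 => [|i _]; last by rewrite mxE expr0n.
by rewrite sqrtr0 expr0n mulr0.
Qed.

Lemma displacement_snapshots1 (R : realType) N nt (w : nat -> 'cV[R]_N) n :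
  (n <= nt)%N -> w n - w 0%N \in <<snapshots1 nt w>>%VS.
Proof.
case: n => [|n] lent; first by rewrite subrr mem0v.
apply: memv_span; apply/mapP; exists n.+1 => //.
by rewrite mem_iota add1n ltnS.
Qed.

Lemma displacement_snapshots2 (R : realType) N nt (w : nat -> 'cV[R]_N) n :
  (n <= nt)%N -> w n - w 0%N \in <<snapshots2 nt w>>%VS.
Proof.
move=> lent; rewrite -telescope_sumr // big_mkord.
apply: memv_suml => k _; apply: memv_span; apply/mapP; exists k.+1 => //.
by rewrite mem_iota add1n /= (leq_ltn_trans (ltn_ord k)) ?ltnS.
Qed.

Lemma not_truncated_coords (R : realType) N nw (X : seq 'cV[R]_N) (Phi : 'M[R]_(N, nw))
    (x : 'cV[R]_N) :
  not_truncated X Phi -> x \in <<X>>%VS -> exists y, x = Phi *m y.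
Proof. by move=> <- /memv_imgP[y _ ->]; exists y; rewrite lfunE. Qed.

Lemma card_eq1_inj T (A : set T) (x y : T) : A #= `I_1 -> A x -> A y -> x = y.
Proof.
move=> /card_set_bijP[f [fA finj _]] Ax Ay.
apply: finj; rewrite ?inE //.
by have := fA x Ax; have := fA y Ay; rewrite !II1 /= => -> ->.
Qed.

(** The two histories fed to [Sres] coincide, so step [n] of the reduced-order
model and step [n] of the high-dimensional model have one and the same residual
function. *)
Lemma rom_residual_eq (R : realType) N d nw (Sres : @residual_family R N d)
    (w : nat -> 'cV[R]_d -> 'cV[R]_N) (Phi : 'M[R]_(N, nw))
    (wr : nat -> 'cV[R]_d -> 'cV[R]_nw) n v mu :
  (forall k, (k <= n)%N -> rom_state w Phi wr k mu = w k mu) ->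
  rom_residual Sres w Phi wr n v mu = Sres n v [ffun k : 'I_n.+1 => w k mu] mu.
Proof.
move=> agree; congr (Sres n v _ mu); apply/ffunP => k; rewrite !ffunE.
by case: eqP => [->//|_]; apply: agree; rewrite -ltnS.
Qed.

Theorem propositionA1 (R : realType) (N d nt nw : nat)
    (D : set 'cV[R]_d) (mu_train : 'cV[R]_d)
    (res : nat -> 'cV[R]_N -> 'cV[R]_d -> 'cV[R]_N)
    (Sres : @residual_family R N d)
    (w : nat -> 'cV[R]_d -> 'cV[R]_N)
    (Phi : 'M[R]_(N, nw))
    (wr init : nat -> 'cV[R]_d -> 'cV[R]_nw)
    (hmu_train : D mu_train)
    (hS : forall n mu v, (n < nt)%N -> D mu ->
       Sres n v [ffun k : 'I_n.+1 => w k mu] mu = res n v mu)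
    (hHDM : forall n mu, (n < nt)%N -> D mu -> res n (w n.+1 mu) mu = 0)
    (hPOD :
       let W1 := snapshots1 nt (w ^~ mu_train) in
       let W2 := snapshots2 nt (w ^~ mu_train) in
       (pod_basis W1 Phi /\ not_truncated W1 Phi) \/
       (pod_basis W2 Phi /\ not_truncated W2 Phi))
    (hdiff : forall n mu y, (n < nt)%N -> D mu ->
       differentiable (objective Sres w Phi wr n mu) y)
    (hargmin : forall n mu, (n < nt)%N -> D mu ->
       argmin (objective Sres w Phi wr n mu) (wr n.+1 mu))
    (hGN : forall n mu, (n < nt)%N -> D mu ->
       gauss_newton (reduced_residual Sres w Phi wr n mu)
         (init n mu) (wr n.+1 mu))
    (hinit : forall mu, D mu -> wr 0%N mu = 0)
    (hstat : forall n mu, (n < nt)%N -> D mu ->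
       stationary_in_level_set (objective Sres w Phi wr n mu)
         (init n mu) (wr n.+1 mu))
    (huniq : forall n mu, (n < nt)%N -> D mu ->
       stationary_in_level_set (objective Sres w Phi wr n mu)
         (init n mu) #= `I_1) :
  forall n, (n <= nt)%N -> rom_state w Phi wr n mu_train = w n mu_train.
Proof.
elim/ltn_ind=> -[|n] IH lent.
  by rewrite /rom_state hinit // mulmx0 addr0.
have [y yE] : exists y, w n.+1 mu_train - w 0%N mu_train = Phi *m y.
  case: hPOD => -[_ nt_Phi]; apply: (not_truncated_coords nt_Phi).
    exact: (@displacement_snapshots1 R N nt (w ^~ mu_train)).
  exact: (@displacement_snapshots2 R N nt (w ^~ mu_train)).
have wE : w 0%N mu_train + Phi *m y = w n.+1 mu_train by rewrite -yE addrC subrK.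
have agree k : (k <= n)%N -> rom_state w Phi wr k mu_train = w k mu_train.
  by move=> lekn; apply: IH => //; exact: leq_trans lekn (ltnW lent).
have fy0 : objective Sres w Phi wr n mu_train y = 0.
  by rewrite /objective /reduced_residual wE rom_residual_eq // hS // hHDM //
             half_sqnorm0.
have ymin : argmin (objective Sres w Phi wr n mu_train) y.
  by move=> z; rewrite fy0; exact: half_sqnorm_ge0.
have wry : wr n.+1 mu_train = y.
  apply: card_eq1_inj (huniq _ _ lent hmu_train) (hstat _ _ lent hmu_train) _.
  split; first exact: ymin.
  by apply: gradient_at_argmin => // x; exact: hdiff.
by rewrite /rom_state wry wE.
Qed.
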